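(* Let $\mu,\nu$ be Borel probability measures on $\mathbb{R}^d$ with compact supports and $\mu\ll\mathcal{L}^d$. Let $c:\mathbb{R}^d\times\mathbb{R}^d\to\mathbb{R}^+$ be continuous and satisfy: (i) for every $x$ there is a unique $y\in\mathbb{R}^d$ with $c(x,y)=0$, and for every $y\in\mathbb{R}^d$, $\inf_{x\in\mathbb{R}^d}c(x,y)=0$; (ii) for every $y$, $c(\cdot,y)$ is strictly quasiconvex: $c((1-t)x+t\bar x,y)<\max\{c(x,y),c(\bar x,y)\}$ for all $t\in(0,1)$ and all $x\neq\bar x$; (iii) for all $\lambda>0$ and $y\in\mathbb{R}^d$, the convex set $\{z: c(z,y)\le\lambda\}$ has differentiable ($C^1$) boundary; (iv) for all $x,y,\tilde y\in\mathbb{R}^d$ and all $\lambda>0$: if $c(x,y)=c(x,\tilde y)=\lambda$ and $n_{c(\cdot,y)}(x)=n_{c(\cdot,\tilde y)}(x)$, then $y=\tilde y$. If $\gamma\in\Pi(\mu,\nu)$ is $\infty$-monotone, then $\gamma$ vanishes outside the graph of a Borel map $T:\mathbb{R}^d\to\mathbb{R}^d$ with $T_\sharp\mu=\nu$.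
   Context: $\Pi(\mu,\nu)$ is the set of Borel probability measures on $\mathbb{R}^d\times\mathbb{R}^d$ with marginals $\mu$ and $\nu$. For $y\in\mathbb{R}^d$ and $x$ with $c(x,y)=\lambda>0$, $n_{c(\cdot,y)}(x)$ denotes the unit outer normal at $x$ to the sublevel set $\{z: c(z,y)\le\lambda\}$. A set $\Gamma\subset\mathbb{R}^d\times\mathbb{R}^d$ is $\infty$-monotone if for all $(x,y),(x',y')\in\Gamma$, $\max\{c(x,y),c(x',y')\}\le\max\{c(x,y'),c(x',y)\}$; a plan $\gamma$ is $\infty$-monotone if it is concentrated on an $\infty$-monotone set. *)

(* Defs.v *)
From HB Require Import structures.
From mathcomp Require Import all_boot all_order all_algebra.
From mathcomp Require Import all_classical all_reals all_analysis.
Set Implicit Arguments. Unset Strict Implicit. Unset Printing Implicit Defensive.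
Import Order.TTheory GRing.Theory Num.Theory.
Import numFieldNormedType.Exports.
Local Open Scope classical_set_scope.
Local Open Scope ring_scope.

(* Euclidean space R^d is modelled as row vectors 'rV[R]_d (with the product
   topology of mathcomp-analysis).  Its Borel sigma-algebra: *)
Definition borelRd (R : realType) (d : nat) :=
  g_sigma_algebraType (@open 'rV[R]_d).

Definition dotv (R : realType) (d : nat) (u v : 'rV[R]_d) : R :=
  \sum_(i < d) u 0 i * v 0 i.

Definition box (R : realType) (d : nat) (a b : 'rV[R]_d) : set 'rV[R]_d :=
  [set x | forall i, a 0 i <= x 0 i <= b 0 i].
Definition box_vol (R : realType) (d : nat) (a b : 'rV[R]_d) : R :=
  \prod_(i < d) (b 0 i - a 0 i).
Definition lebesgue_null (R : realType) (d : nat) (A : set 'rV[R]_d) : Prop :=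
  forall eps : R, 0 < eps ->
    exists a b : nat -> 'rV[R]_d,
      (forall n i, a n 0 i <= b n 0 i) /\
      A `<=` \bigcup_n box (a n) (b n) /\
      (\sum_(0 <= n <oo) ((box_vol (a n) (b n))%:E) <= eps%:E)%E.

Definition abs_cont_leb (R : realType) (d : nat)
  (mu : probability (borelRd R d) R) : Prop :=
  forall A : set (borelRd R d), measurable A ->
    lebesgue_null (A : set 'rV[R]_d) -> mu A = 0%E.

Definition msupport (R : realType) (d : nat)
  (mu : probability (borelRd R d) R) : set 'rV[R]_d :=
  [set x | forall U : set 'rV[R]_d, open U -> U x -> (0 < mu U)%E].

Definition is_plan (R : realType) (d : nat)
  (mu nu : probability (borelRd R d) R)
  (gam : probability (borelRd R d * borelRd R d)%type R) : Prop :=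
  (forall A : set (borelRd R d), measurable A -> gam (fst @^-1` A) = mu A) /\
  (forall B : set (borelRd R d), measurable B -> gam (snd @^-1` B) = nu B).

Definition concentrated_on (d0 : measure_display) (T : measurableType d0)
  (R : realType) (gam : probability T R) (S : set T) : Prop :=
  exists N : set T, measurable N /\ gam N = 0%E /\ ~` S `<=` N.

Definition infty_monotone_set (R : realType) (d : nat)
  (c : 'rV[R]_d -> 'rV[R]_d -> R) (G : set ('rV[R]_d * 'rV[R]_d)) : Prop :=
  forall p q, G p -> G q ->
    Num.max (c p.1 p.2) (c q.1 q.2) <= Num.max (c p.1 q.2) (c q.1 p.2).

Definition infty_monotone (R : realType) (d : nat)
  (c : 'rV[R]_d -> 'rV[R]_d -> R)
  (gam : probability (borelRd R d * borelRd R d)%type R) : Prop :=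
  exists G : set ('rV[R]_d * 'rV[R]_d),
    infty_monotone_set c G /\ concentrated_on gam G.

Definition sublevel (R : realType) (d : nat) (c : 'rV[R]_d -> 'rV[R]_d -> R)
  (y : 'rV[R]_d) (lam : R) : set 'rV[R]_d := [set z | c z y <= lam].

Definition is_unit_outer_normal (R : realType) (d : nat) (K : set 'rV[R]_d)
  (x n : 'rV[R]_d) : Prop :=
  dotv n n = 1 /\ forall z, K z -> dotv n (z - x) <= 0.

Definition tboundary (R : realType) (d : nat) (K : set 'rV[R]_d) :=
  closure K `\` K°.

Definition normal_c (R : realType) (d : nat) (c : 'rV[R]_d -> 'rV[R]_d -> R)
  (y x : 'rV[R]_d) : 'rV[R]_d :=
  xget 0 [set n | is_unit_outer_normal (sublevel c y (c x y)) x n].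

(* Main.v *)
(* By continuity of c the monotone set may be replaced by its closure G. Call x
   good if, whenever (x, y) is in G, every open cone with vertex x contains, at
   arbitrarily small scales, points x' having some y' close to y with (x', y')
   in G.  The points of a set A whose cone in a fixed direction misses A form a
   uniformly porous, hence Lebesgue null, set; running over countably many
   cones and countably many cells of the target space, mu-almost every x is
   good.

   If x is good and (x, y0), (x, y1) are in G with c x y1 <= c x y0, move x to
   x' in a direction v.  When the inequality is strict, take v = - n0, where n0
   is the normal at x for y0, and y' near y1: c x' y0 and c x y' are both below
   c x y0.  In the case of equality, y0 != y1 forces n0 != n1; take v = n0 - n1
   and y' near y0: then c x' y1 < c x y1 and c x y' < c x' y'.  Both contradict
   monotonicity.  This uses only that normals at nearby points for nearby
   targets are close, which follows from compactness of the sphere and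
   uniqueness of normals.

   So G has at most one point above each good x.  Since G is closed, projections
   of G /\ (X * C) with C closed are countable unions of compact sets, and the
   resulting map is Borel. *)
Require Import Defs.
From HB Require Import structures.
From mathcomp Require Import all_boot all_order all_algebra.
From mathcomp Require Import all_classical all_reals all_analysis.
From mathcomp Require Import ring lra.
Import Order.TTheory GRing.Theory Num.Theory.
Import numFieldNormedType.Exports.
Local Open Scope classical_set_scope.
Local Open Scope ring_scope.

Set Implicit Arguments. Unset Strict Implicit. Unset Printing Implicit Defensive.

(** * Cube covers and porous sets *)

Definition cube (R : realType) (d : nat) (a : 'rV[R]_d) (s : R) : set 'rV[R]_d :=
  [set x | forall i, a 0 i <= x 0 i <= a 0 i + s].

Definition subcorner (R : realType) (d M : nat) (a : 'rV[R]_d) (s : R)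
  (k : {ffun 'I_d -> 'I_M}) : 'rV[R]_d := \row_i (a 0 i + (k i)%:R * s).

(* Every open cone contains, near its vertex, some {tau (w + u) : |u| <= 1,
   0 < tau < 1 / (m + 1)} with w integral, so that countably many cones suffice. *)
Definition avoids_cone (R : realType) (d : nat) (A : set 'rV[R]_d)
    (w : {ffun 'I_d -> int}) (m : nat) : set 'rV[R]_d :=
  [set x | A x /\ forall (tau : R) (u : 'rV[R]_d), 0 < tau < m.+1%:R^-1 ->
    (forall i, `|u 0 i| <= 1) ->
    ~ A (\row_i (x 0 i + tau * ((w i)%:~R + u 0 i)))].

Section covering.
Context {R : realType} {d : nat}.
Implicit Types (A B : set 'rV[R]_d) (a x : 'rV[R]_d) (s : R).

Lemma unit_subdivision (M : nat) (t : R) : (0 < M)%N -> 0 <= t <= M%:R ->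
  exists k : 'I_M, k%:R <= t <= k%:R + 1.
Proof.
case: M => // M _; elim: M t => [|M IH] t /andP[t0 tM].
  by exists ord0; rewrite add0r t0.
have [tM'|tM'] := leP t M.+1%:R.
  have [|k kt] := IH t; first by rewrite t0.
  by exists (widen_ord (leqnSn _) k).
by exists ord_max; rewrite /= (ltW tM') -natr1 in tM *.
Qed.

Lemma cube_subdivision (M : nat) a x s : (0 < M)%N -> 0 < s ->
  cube a (M%:R * s) x ->
  exists k : {ffun 'I_d -> 'I_M}, cube (subcorner a s k) s x.
Proof.
move=> M0 s0 ax.
have /choice[k kP] : forall i, exists k : 'I_M,
    k%:R <= (x 0 i - a 0 i) / s <= k%:R + 1.
  move=> i; apply: unit_subdivision => //; have := ax i.
  rewrite ler_pdivlMr // ler_pdivrMr // mul0r; lra.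
exists [ffun i => k i] => i; have := kP i.
rewrite !mxE ffunE ler_pdivlMr // ler_pdivrMr // mulrDl mul1r; lra.
Qed.

(* Each of the cubes of a cover is cut into M ^ d cells, one of which misses B. *)
Lemma porous_cover (M : nat) B (s0 : R) : (0 < M)%N ->
  (forall a s, 0 < s < s0 -> exists k : {ffun 'I_d -> 'I_M},
    B `&` cube (subcorner a s k) s = set0) ->
  forall n a s, 0 < s < s0 ->
  exists l : seq 'rV[R]_d, (size l <= (M ^ d).-1 ^ n)%N /\
    B `&` cube a s `<=` \bigcup_(b in [set` l]) cube b (s / M%:R ^+ n).
Proof.
move=> M0 porous n a s /andP[s0' ss0].
have MR : 1 <= M%:R :> R by rewrite ler1n.
have Mn0 n' : 0 < M%:R ^+ n' :> R by rewrite exprn_gt0 // ltr0n.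
elim: n => [|n [l [sl lP]]].
  exists [:: a]; split; first by rewrite expn0.
  by move=> x [_ ax]; exists a; rewrite /= ?inE// expr0 divr1.
set s1 := s / M%:R ^+ n.+1.
have s10 : 0 < s1 < s0.
  rewrite divr_gt0 //=.
  apply: le_lt_trans ss0; rewrite ler_pdivrMr //.
  by apply: ler_peMr; [exact: ltW | exact: exprn_ege1].
have s1E : s / M%:R ^+ n = M%:R * s1.
  rewrite /s1 exprS invfM; field.
  by rewrite !lt0r_neq0 // ltr0n.
have /choice[k0 k0P] := fun a => porous a s1 s10.
pose F b := [seq subcorner b s1 k | k <- enum {ffun 'I_d -> 'I_M} & k != k0 b].
exists (flatten [seq F b | b <- l]); split.
  rewrite size_flatten /shape -map_comp sumnE big_map expnSr.
  apply: leq_trans (leq_mul sl (leqnn _)).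
  apply: (@leq_trans (\sum_(b <- l) (M ^ d).-1)%N); last first.
    by rewrite big_const_seq count_predT iter_addn_0 mulnC.
  apply: leq_sum => b _.
  rewrite /F /= size_map size_filter.
  have := count_predC (pred1 (k0 b)) (enum {ffun 'I_d -> 'I_M}).
  rewrite -cardE card_ffun !card_ord => <-.
  by rewrite count_uniq_mem ?enum_uniq // mem_enum inE add1n.
move=> x [Bx ax]; have [b /= bl bx] := lP x (conj Bx ax).
rewrite s1E in bx.
have [k kx] := cube_subdivision M0 (proj1 (andP s10)) bx.
exists (subcorner b s1 k) => //=; apply/flatten_mapP; exists b => //.
apply: map_f; rewrite mem_filter mem_enum andbT.
apply/eqP => kk0; have : set0 x by rewrite -(k0P b) -kk0.
by [].
Qed.

Lemma lebesgue_null_cubes A : (0 < d)%N ->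
  (forall e : R, 0 < e -> exists (l : seq 'rV[R]_d) s, [/\ 0 <= s,
     (size l)%:R * s ^+ d <= e & A `<=` \bigcup_(b in [set` l]) cube b s]) ->
  lebesgue_null A.
Proof.
move=> d0 small e /small[l [s [s0 le Al]]].
(* The finite cover is continued by degenerate boxes, whose volume [0 ^+ d] vanishes because
   [0 < d]. *)
pose side n := if (n < size l)%N then s else 0.
exists (nth 0 l), (fun n => \row_i (nth 0 l n 0 i + side n)); split; last split.
- by move=> n i; rewrite mxE lerDl /side; case: ifP.
- move=> x /Al[b /= bl bx]; exists (index b l) => // i; have := bx i.
  by rewrite !mxE nth_index // /side index_mem bl.
have volE n : box_vol (nth 0 l n) (\row_i (nth 0 l n 0 i + side n)) = side n ^+ d.
  rewrite /box_vol (eq_bigr (fun=> side n)); last first.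
    by move=> i _; rewrite mxE addrAC subrr add0r.
  by rewrite prodr_const card_ord.
have side0 n : 0 <= side n by rewrite /side; case: ifP.
apply: lime_le.
  by apply: is_cvg_nneseries => n _ _; rewrite volE lee_fin exprn_ge0.
apply: nearW => n; rewrite sumEFin lee_fin; apply: le_trans le.
under eq_bigr do rewrite volE.
have [nl|/ltnW ln] := leqP n (size l).
  apply: le_trans (_ : \sum_(0 <= i < n) s ^+ d <= _).
    apply: ler_sum => i _; rewrite /side; case: ifP => // _.
    by rewrite expr0n (gtn_eqF d0) exprn_ge0.
  rewrite sumr_const_nat subn0 -(mulr_natl (s ^+ d) n) ler_wpM2r ?exprn_ge0 // ler_nat //.
rewrite (big_cat_nat (leq0n _) ln) /= [X in _ + X]big_nat [X in _ + X]big1 ?addr0.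
  rewrite big_nat (eq_bigr (fun=> s ^+ d)); last first.
    by move=> i /andP[_ il]; rewrite /side il.
  by rewrite -big_nat sumr_const_nat subn0 mulr_natl.
move=> i /andP[li _]; rewrite /side ltnNge li /= expr0n.
by rewrite (gtn_eqF d0).
Qed.

(** After [n] subdivisions the remaining cubes have total volume at most [s ^+ d * q ^+ n], where
    [q = (M ^ d - 1) / M ^ d < 1]. *)
Lemma porous_lebesgue_null (M : nat) B (s0 : R) a s : (0 < d)%N -> (0 < M)%N ->
  (forall a s, 0 < s < s0 -> exists k : {ffun 'I_d -> 'I_M},
    B `&` cube (subcorner a s k) s = set0) ->
  0 < s < s0 -> lebesgue_null (B `&` cube a s).
Proof.
move=> d0 M0 porous ss; apply: lebesgue_null_cubes => // e e0.
have s_gt0 : 0 < s by case/andP: ss.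
have MR : 0 < M%:R :> R by rewrite ltr0n.
pose q : R := (M ^ d).-1%:R / (M ^ d)%:R.
have Md0 : (0 < M ^ d)%N by rewrite expn_gt0 M0.
have MdR : 0 < (M ^ d)%:R :> R by rewrite ltr0n.
have q1 : `|q| < 1.
  rewrite ger0_norm ?divr_ge0 // ltr_pdivrMr // mul1r ltr_nat.
  by rewrite prednK.
have /cvgrPdist_lt/(_ e e0)[n _ /(_ n (leqnn n))] := cvg_geometric (s ^+ d) q1.
rewrite /= sub0r normrN /geometric /= => qe.
have [l [sl lP]] := porous_cover M0 porous n a ss.
exists l, (s / M%:R ^+ n); split=> //.
  by rewrite divr_ge0 ?exprn_ge0 // ltW.
apply: le_trans (ltW (le_lt_trans (ler_norm _) qe)).
rewrite /q !expr_div_n -[_.-1%:R ^+ n]natrX [(M ^ d)%:R]natrX -!exprM [(d * n)%N]mulnC.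
rewrite mulrCA ler_wpM2l ?exprn_ge0 ?(ltW s_gt0) //.
by rewrite ler_wpM2r ?invr_ge0 ?exprn_ge0 ?(ltW MR) // ler_nat.
Qed.

End covering.

(** * Points with an avoided cone are negligible *)

Section avoids_cone_null.
Context {R : realType} {d : nat}.
Implicit Types (A : set 'rV[R]_d).

(** A point of cell [k'] lies in the cone of direction [w] at any point of cell [k]. The number of
    cells per side exceeds every [|w i|], so both cells fit in the grid. *)
Lemma avoids_cone_porous A (w : {ffun 'I_d -> int}) (m : nat) :
  exists M : nat, (0 < M)%N /\ forall a s, 0 < s < m.+1%:R^-1 ->
    exists k : {ffun 'I_d -> 'I_M},
      avoids_cone A w m `&` cube (subcorner a s k) s = set0.
Proof.
pose M := (\sum_i `|w i|%N)%N.
have wM i : (`|w i|%N < M.+1)%N by rewrite ltnS /M (bigD1 i) //= leq_addr.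
exists M.+1; split => // a s /andP[s0 sm].
(* The cells k and k' differ by w, so they cannot both meet the set. *)
pose k : {ffun 'I_d -> 'I_M.+1} :=
  [ffun i => if (w i < 0)%R then Ordinal (wM i) else ord0].
pose k' : {ffun 'I_d -> 'I_M.+1} :=
  [ffun i => if (w i < 0)%R then ord0 else Ordinal (wM i)].
have wE i : (w i)%:~R = (k' i)%:R - (k i)%:R :> R.
  rewrite !ffunE; case: ltP => wi /=.
    by rewrite sub0r -{1}[w i]opprK -{1}(ltr0_norm wi) -abszE mulrNz.
  by rewrite subr0 -{1}(ger0_norm wi) -abszE.
have [kB|/set0P[x [[Ax xP] xk]]] :=
  eqVneq (avoids_cone A w m `&` cube (subcorner a s k) s) set0.
  by exists k.
exists k'; apply/seteqP; split => // x' [[Ax' _] xk'] /=.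
(* The side [s] serves as the scale [tau]: positions inside two cells of side [s] differ by at most
   [s] per coordinate, which gives [|u i| <= 1]. *)
pose u : 'rV[R]_d := \row_i ((x' 0 i - x 0 i) / s - (w i)%:~R).
apply: (xP s u); first by rewrite s0.
  move=> i; rewrite mxE wE; have := xk i; have := xk' i; rewrite !mxE.
  move=> h h'; rewrite ler_norml -(ler_pM2r s0) -[_ <= 1](ler_pM2r s0).
  rewrite mulrBl divfK ?gt_eqF //; lra.
suff -> : \row_i (x 0 i + s * ((w i)%:~R + u 0 i)) = x' by [].
apply/rowP => i; rewrite !mxE; field; exact: lt0r_neq0.
Qed.

Lemma grid_cover (s : R) (x : 'rV[R]_d) : 0 < s ->
  exists z : {ffun 'I_d -> int}, cube (\row_i ((z i)%:~R * s)) s x.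
Proof.
move=> s0; exists [ffun i => Num.floor (x 0 i / s)] => i; rewrite !mxE ffunE.
have := floor_itv (x 0 i / s).
rewrite intrD ler_pdivlMr // ltr_pdivrMr // mulrDl mul1r; lra.
Qed.

Lemma negligible_bigcup_countType (I : countType) (d0 : measure_display)
    (T : measurableType d0) (mu : {measure set T -> \bar R}) (F : I -> set T) :
  (forall i, mu.-negligible (F i)) -> mu.-negligible (\bigcup_i F i).
Proof.
move=> negF.
pose G n := if unpickle n is Some i then F i else set0.
apply: (@negligibleS _ _ _ _ (\bigcup_n G n)) => [x [i _ Fx]|].
  by exists (pickle i) => //; rewrite /G pickleK.
apply: negligible_bigcup => n; rewrite /G.
by case: unpickle => [i|]; [exact: negF | exact: negligible_set0].
Qed.

Lemma box_closed (a b : 'rV[R]_d) : closed (box a b).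
Proof.
have -> : box a b = \bigcap_(i in setT)
    ((fun x : 'rV[R]_d => x 0 i) @^-1` [set t | a 0 i <= t <= b 0 i]).
  by apply/seteqP; split => [x xab i _|x xab i]; [exact: xab | exact: (xab i I)].
apply: closed_bigI => i _; apply: closed_comp => [x _|].
  exact: coord_continuous.
by rewrite -set_itvcc; exact: interval_closed.
Qed.

Lemma closed_borel A : closed A -> measurable (A : set (borelRd R d)).
Proof.
move=> cA; rewrite -(setCK A); apply: measurableC.
by apply: sub_sigma_algebra; exact: closed_openC.
Qed.

(** Absolute continuity concerns measurable sets only, so [A] is enlarged to a Borel null set: the
    intersection of box covers of volume at most [1 / (n + 1)]. *)
Lemma lebesgue_null_negligible (mu : probability (borelRd R d) R) A :
  abs_cont_leb mu -> lebesgue_null A -> mu.-negligible (A : set (borelRd R d)).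
Proof.
move=> ac nullA.
have /choice[F FP] : forall n : nat, exists ab : (nat -> 'rV[R]_d) * (nat -> 'rV[R]_d),
    [/\ forall n i, ab.1 n 0 i <= ab.2 n 0 i,
        A `<=` \bigcup_n box (ab.1 n) (ab.2 n) &
        (\sum_(0 <= k <oo) (box_vol (ab.1 k) (ab.2 k))%:E <= (n.+1%:R^-1)%:E)%E].
  move=> n; have [|a [b [? [? ?]]]] := nullA n.+1%:R^-1; last by exists (a, b).
  by rewrite invr_gt0.
pose E : set 'rV[R]_d := \bigcap_n \bigcup_k box ((F n).1 k) ((F n).2 k).
have mE : measurable (E : set (borelRd R d)).
  apply: bigcapT_measurable => n; apply: bigcupT_measurable => k.
  by apply: closed_borel; exact: box_closed.
exists E; split => //; last by move=> x Ax n _; have [_ AF _] := FP n; exact: AF.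
apply: ac => // e e0.
have [n _ ne] := near_infty_natSinv_lt (PosNum e0).
exists (F n).1, (F n).2; have [le _ vol] := FP n; split => //; split.
  by move=> x; apply.
by apply: le_trans vol _; rewrite lee_fin ltW //; exact: (ne n (leqnn n)).
Qed.

Lemma avoids_cone_negligible (mu : probability (borelRd R d) R) A w m :
  abs_cont_leb mu -> mu.-negligible (avoids_cone A w m : set (borelRd R d)).
Proof.
move=> ac; (* For d = 0 boxes have volume 1 (empty product), and no set is lebesgue_null. *)
have [d0|d_gt0] := posnP d.
  suff -> : avoids_cone A w m = set0 by exact: negligible_set0.
  (* The space has a single point, so the shifted point is [x] again and lies in [A]. *)
  apply/seteqP; split => // x [Ax /(_ (m.+1%:R^-1 / 2) 0)] [|i|].
  - by rewrite divr_gt0 //= gtr_pMr // invf_lt1 // ltr1n.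
  - by rewrite mxE normr0.
  rewrite (_ : \row_i _ = x) //; apply/rowP => i.
  by have := leq_ltn_trans (leq0n i) (ltn_ord i); rewrite {1}d0.
have [M [M0 porous]] := avoids_cone_porous A w m.
(* Porosity is known only at scales below [1 / (m + 1)]; a grid of smaller mesh cuts the set into
   countably many pieces. *)
pose s : R := m.+1%:R^-1 / 2.
have ss : 0 < s < m.+1%:R^-1.
  by rewrite divr_gt0 //= gtr_pMr // invf_lt1 // ltr1n.
have s0 : 0 < s by case/andP: ss.
apply: (@negligibleS _ (borelRd R d) _ mu (\bigcup_(z : {ffun 'I_d -> int})
  (avoids_cone A w m `&` cube (\row_i ((z i)%:~R * s)) s))).
  by move=> x xA; have [z zx] := grid_cover x s0; exists z.
apply: negligible_bigcup_countType => z; apply: lebesgue_null_negligible => //.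
exact: porous_lebesgue_null d_gt0 M0 porous ss.
Qed.

End avoids_cone_null.

(** * Dot product and unit sphere *)

Section dot_product.
Context {R : realType} {d : nat}.
Implicit Types (u v w : 'rV[R]_d).

Lemma dotvC u v : dotv u v = dotv v u.
Proof. by apply: eq_bigr => i _; rewrite mulrC. Qed.

Lemma dotvDr u v w : dotv u (v + w) = dotv u v + dotv u w.
Proof. by rewrite -big_split; apply: eq_bigr => i _; rewrite mxE mulrDr. Qed.

Lemma dotvZr (t : R) u v : dotv u (t *: v) = t * dotv u v.
Proof. by rewrite mulr_sumr; apply: eq_bigr => i _; rewrite mxE mulrCA. Qed.

Lemma dotvNr u v : dotv u (- v) = - dotv u v.
Proof. by rewrite -scaleN1r dotvZr mulN1r. Qed.

Lemma dotvBr u v w : dotv u (v - w) = dotv u v - dotv u w.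
Proof. by rewrite dotvDr dotvNr. Qed.

Lemma dotv_eq0 v : dotv v v = 0 -> v = 0.
Proof.
move=> /eqP; rewrite psumr_eq0 => [|i _]; last by rewrite -expr2 sqr_ge0.
move=> /allP v0; apply/rowP => i; rewrite mxE; apply/eqP.
by have := v0 i (mem_index_enum i); rewrite mulf_eq0 orbb.
Qed.

Lemma cvg_dotv (T : Type) (F : set_system T) (f g : T -> 'rV[R]_d) u v :
  Filter F -> f @ F --> u -> g @ F --> v -> dotv (f t) (g t) @[t --> F] --> dotv u v.
Proof.
move=> FF fu gv; apply: cvg_big => [|i _]; first exact: add_continuous.
apply: cvgM.
  exact: (cvg_comp _ (fun w : 'rV[R]_d => w 0 i) fu (@coord_continuous _ _ _ _ _ _)).
exact: (cvg_comp _ (fun w : 'rV[R]_d => w 0 i) gv (@coord_continuous _ _ _ _ _ _)).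
Qed.

Lemma unit_sphere_compact : compact [set m : 'rV[R]_d | dotv m m = 1].
Proof.
have cI : compact [set m : 'rV[R]_d | forall i, `[(-1 : R), 1]%classic (m ord0 i)].
  by apply: (@rV_compact R _ (fun=> `[(-1 : R), 1]%classic)) => _; exact: segment_compact.
apply: subclosed_compact cI _.
  apply: (@closed_comp _ _ (fun m : 'rV[R]_d => dotv m m) [set 1]).
    by move=> m _; apply: (@cvg_dotv _ (nbhs m) id id); exact: cvg_id.
  exact: closed_eq.
move=> m /= m1 i; rewrite /= in_itv /= -ler_norml.
rewrite -(@expr_le1 _ 2) // real_normK ?num_real //.
rewrite -m1 /dotv (bigD1 i) //= expr2 lerDl sumr_ge0 // => j _.
by rewrite -expr2 sqr_ge0.
Qed.

End dot_product.

(** These are the good points. One property [P] near [(0, v, y)] encodes at once the small scale,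
    the direction close to [v] and the target close to [y], so that several requirements can be
    intersected. *)
Definition accessible (R : realType) (d : nat) (G : set ('rV[R]_d * 'rV[R]_d))
    (x : 'rV[R]_d) : Prop :=
  forall (y v : 'rV[R]_d) (P : set (R * 'rV[R]_d * 'rV[R]_d)), G (x, y) ->
    (\forall q \near (0 : R, v, y), P q) ->
  exists t v' y', [/\ 0 < t, G (x + t *: v', y') & P (t, v', y')].

(** * Normals to sublevel sets and uniqueness of the target *)

Section quasiconvex_cost.
Context {R : realType} {d : nat}.
Context (c : 'rV[R]_d -> 'rV[R]_d -> R).
Context (c_cont : continuous (fun p : 'rV[R]_d * 'rV[R]_d => c p.1 p.2)).
Context (c_ge0 : forall x y, 0 <= c x y).
Context (c_zero : forall x, exists! y, c x y = 0).
Context (c_inf : forall y, inf (range (fun x => c x y)) = 0).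
Context (c_sqc : forall y x xb (t : R), 0 < t < 1 -> x != xb ->
  c ((1 - t) *: x + t *: xb) y < Num.max (c x y) (c xb y)).
Context (c_smooth : forall (lam : R) y, 0 < lam -> forall x,
  tboundary (sublevel c y lam) x ->
  exists! n, is_unit_outer_normal (sublevel c y lam) x n).
Context (c_twist : forall x y yt (lam : R), 0 < lam -> c x y = lam -> c x yt = lam ->
  normal_c c y x = normal_c c yt x -> y = yt).
Implicit Types (x y z m n v : 'rV[R]_d).

Definition level_normal y x m := is_unit_outer_normal (sublevel c y (c x y)) x m.

Lemma cvg_cost (T : Type) (F : set_system T) (f g : T -> 'rV[R]_d) x y :
  Filter F -> f @ F --> x -> g @ F --> y -> c (f t) (g t) @[t --> F] --> c x y.
Proof.
move=> FF fx gy.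
exact: (@continuous2_cvg _ _ _ _ F FF f g c x y (@c_cont (x, y)) fx gy).
Qed.

Lemma cost_lt y (lam : R) : 0 < lam -> exists z, c z y < lam.
Proof.
move=> lam0; have [||_ [z _ <-] zlam] := @inf_lt _ (range (c^~ y)) lam.
- by exists (c 0 y); exists 0.
- by rewrite c_inf.
by exists z.
Qed.

(** Take [z] of smaller cost. If [x] were interior, a point slightly beyond [x] on the ray from [z]
    would still have cost at most [c x y]; as [x] lies strictly between the two, strict
    quasiconvexity would give [c x y < c x y]. *)
Lemma level_boundary y x : 0 < c x y -> tboundary (sublevel c y (c x y)) x.
Proof.
move=> cxy; split; first by apply: subset_closure; rewrite /sublevel /=.
move=> xint; have [z zlt] := cost_lt y cxy.
have zx : x != z by apply: contraTneq zlt => <-; rewrite ltxx.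
have near0 : \forall t \near (0 : R), sublevel c y (c x y) (x + t *: (x - z)).
  have : (fun t : R => x + t *: (x - z)) @ 0 --> x + 0 *: (x - z).
    apply: cvgD; first exact: cvg_cst.
    by apply: cvgZr_tmp; exact: cvg_id.
  by rewrite scale0r addr0 => /(_ _ xint).
have [t [t0 tle]] : exists t : R, 0 < t /\ sublevel c y (c x y) (x + t *: (x - z)).
  have /nbhs_ballP[e /= e0 eP] := near0.
  exists (e / 2); split; first by rewrite divr_gt0.
  apply: eP; rewrite /ball /= sub0r normrN gtr0_norm ?divr_gt0 //.
  by rewrite ltr_pdivrMr // ltr_pMr // ltr1n.
have t1 : 0 < 1 + t by rewrite addr_gt0.
have tne : x + t *: (x - z) != z.
  rewrite -subr_eq0 addrAC -{1}[x - z]scale1r -scalerDl scaler_eq0 subr_eq0.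
  by rewrite negb_or (gt_eqF t1).
(* With this weight the convex combination of [x + t *: (x - z)] and [z] is [x]. *)
have := @c_sqc y _ _ (t / (1 + t)) _ tne.
rewrite divr_gt0 //= ltr_pdivrMr // mul1r ltrDr ltr01 => /(_ isT).
have -> : (1 - t / (1 + t)) *: (x + t *: (x - z)) + (t / (1 + t)) *: z = x.
  by apply/rowP => i; rewrite !mxE; field; exact: lt0r_neq0.
by rewrite ltNge ge_max (ltW zlt) andbT => /negP; apply.
Qed.

Lemma level_normal_unique y x : 0 < c x y -> exists! n, level_normal y x n.
Proof. by move=> cxy; apply: c_smooth => //; exact: level_boundary. Qed.

Lemma normal_cE y x n : 0 < c x y -> level_normal y x n -> normal_c c y x = n.
Proof.
move=> cxy nxy; have [n' [n'xy n'uniq]] := level_normal_unique cxy.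
rewrite -(n'uniq _ nxy); apply/esym/n'uniq.
by rewrite /level_normal /normal_c; apply: (@xgetPex _ 0); exists n.
Qed.

(** Failure of normality gives [z] with only [c z y <= c x y]; mixing in a little of a cheaper point
    makes this strict. Both inequalities are then open conditions, hence stable under
    perturbation. *)
Lemma not_normal_witness y x m : 0 < c x y -> dotv m m = 1 ->
  ~ level_normal y x m -> exists z, c z y < c x y /\ 0 < dotv m (z - x).
Proof.
move=> cxy m1 mN.
have [z zle zx] : exists2 z, c z y <= c x y & 0 < dotv m (z - x).
  apply: contrapT => /forall2NP noz; apply: mN; split=> // z zle.
  by rewrite leNgt; apply/negP => zx; have [] := noz z.
have [z0 z0lt] := cost_lt y cxy.
have [zz0|zz0] := eqVneq z z0; first by exists z; rewrite zx {1}zz0.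
set a := dotv m (z - x) in zx *; set b := dotv m (z0 - x).
have ab : 0 < a + `|b| by rewrite ltr_pwDl.
(* Chosen so that [(1 - t) * a + t * b >= a - t * (a + |b|) = a / 2 > 0]. *)
pose t := a / (2 * (a + `|b|)).
have t01 : 0 < t < 1.
  rewrite divr_gt0 ?mulr_gt0 //= ltr_pdivrMr ?mulr_gt0 // mul1r.
  by have := normr_ge0 b; lra.
exists ((1 - t) *: z + t *: z0); split.
  by apply: lt_le_trans (c_sqc y t01 zz0) _; rewrite ge_max zle ltW.
have -> : (1 - t) *: z + t *: z0 - x = (1 - t) *: (z - x) + t *: (z0 - x).
  by apply/rowP => i; rewrite !mxE; ring.
rewrite dotvDr !dotvZr -/a -/b.
have tE : t * (a + `|b|) = a / 2.
  by rewrite /t; field; rewrite lt0r_neq0.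
have : t * (- b) <= t * `|b|.
  by rewrite ler_wpM2l ?(ltW (proj1 (andP t01))) // -normrN ler_norm.
lra.
Qed.

(** By compactness of the sphere it suffices to argue near each unit [m]. If [m] is normal at [x],
    it equals [n] and positivity persists; otherwise a witness against [m] remains one nearby, so
    there are no normals there. *)
Lemma level_normal_near y x n v : 0 < c x y -> level_normal y x n ->
  0 < dotv n v ->
  \forall q \near (x, y, v), forall m, level_normal q.1.2 q.1.1 m -> 0 < dotv m q.2.
Proof.
move=> cxy nxy nv.
have [n' [n'xy n'uniq]] := level_normal_unique cxy.
pose P (q : 'rV[R]_d * 'rV[R]_d * 'rV[R]_d) m :=
  level_normal q.1.2 q.1.1 m -> 0 < dotv m q.2.
have /compact_near_coveringP cov := @unit_sphere_compact R d.
have : \forall q \near (x, y, v), [set m | dotv m m = 1] `<=` P q.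
  apply: (@cov _ (nbhs (x, y, v)) P _) => m m1.
  pose F := filter_prod (nbhs m) (nbhs (x, y, v)).
  change (F (fun q => P q.2 q.1)).
  have FF : Filter F by exact: filter_prod_filter.
  have fstF : fst q @[q --> F] --> m by exact: cvg_fst.
  have xF : q.2.1.1 @[q --> F] --> x.
    exact: (cvg_comp _ _ cvg_snd (cvg_comp _ _ cvg_fst cvg_fst)).
  have yF : q.2.1.2 @[q --> F] --> y.
    exact: (cvg_comp _ _ cvg_snd (cvg_comp _ _ cvg_fst cvg_snd)).
  have vF : q.2.2 @[q --> F] --> v by exact: (cvg_comp _ _ cvg_snd cvg_snd).
  have [mxy|/(not_normal_witness cxy m1)[z [zlt zm]]] := pselect (level_normal y x m).
    have mv : 0 < dotv m v by rewrite -(n'uniq _ mxy) (n'uniq _ nxy).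
    have H := @cvgr_gt _ _ F FF _ _ (cvg_dotv FF fstF vF) _ mv.
    by apply: filterS H => -[m' q] /= + _.
  have cz : 0 < c x y - c z y by rewrite subr_gt0.
  have zF : (fun=> z) @ F --> z by exact: cvg_cst.
  have cF : c q.2.1.1 q.2.1.2 - c z q.2.1.2 @[q --> F] --> c x y - c z y.
    by apply: cvgB; exact: cvg_cost.
  have H1 := @cvgr_gt _ _ F FF _ _ cF _ cz.
  have dF : dotv q.1 (z - q.2.1.1) @[q --> F] --> dotv m (z - x).
    by apply: cvg_dotv => //; exact: cvgB.
  have H2 := @cvgr_gt _ _ F FF _ _ dF _ zm.
  apply: filterS2 H1 H2 => -[m' q] /= H1 H2 [_ /(_ z) h]; exfalso.
  move: H1; rewrite subr_gt0 => /ltW/h; rewrite leNgt => /negP; exact.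
by apply: filterS => q qP m mq; apply: qP => //; case: mq.
Qed.

(** Otherwise [x] lies in the sublevel set through the moved point, whose normal [m] satisfies
    [dotv m v' >= 0], against [level_normal_near] for [- v]. The target [y'] is arbitrary so that
    the neighbourhood can be intersected with one around a moving target. *)
Lemma cost_decreases y x n v y' : 0 < c x y -> level_normal y x n ->
  dotv n v < 0 ->
  \forall q \near (0 : R, v, y'),
    0 < q.1.1 -> c (x + q.1.1 *: q.1.2) y < c x y.
Proof.
move=> cxy nxy nv; have nNv : 0 < dotv n (- v) by rewrite dotvNr oppr_gt0.
have near_n := level_normal_near cxy nxy nNv.
pose F : set_system (R * 'rV[R]_d * 'rV[R]_d) := nbhs (0 : R, v, y').
have FF : Filter F by exact: nbhs_filter.
have tF : q.1.1 @[q --> F] --> (0 : R) by exact: (cvg_comp _ _ cvg_fst cvg_fst).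
have vF : q.1.2 @[q --> F] --> v by exact: (cvg_comp _ _ cvg_fst cvg_snd).
have xF : x + q.1.1 *: q.1.2 @[q --> F] --> x.
  rewrite -[X in _ --> X]addr0 -(scale0r v); apply: cvgD; first exact: cvg_cst.
  exact: cvgZ.
have yF : (fun=> y) @ F --> y by exact: cvg_cst.
have NvF : - q.1.2 @[q --> F] --> - v by exact: cvgN.
have phiF : (x + q.1.1 *: q.1.2, y, - q.1.2) @[q --> F] --> (x, y, - v).
  apply: (@cvg_pair _ _ _ F (nbhs (x, y)) (nbhs (- v))) => //.
  exact: (@cvg_pair _ _ _ F (nbhs x) (nbhs y)).
have H : F [set q | forall m, level_normal y (x + q.1.1 *: q.1.2) m ->
    0 < dotv m (- q.1.2)] := phiF _ near_n.
change (F [set q | 0 < q.1.1 -> c (x + q.1.1 *: q.1.2) y < c x y]).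
apply: filterS H => -[[t v'] y0] /= H t0.
rewrite ltNge; apply/negP => cle.
have cx'y : 0 < c (x + t *: v') y by apply: lt_le_trans cle.
have [m [mx' _]] := level_normal_unique cx'y.
have := (proj2 mx') x cle; rewrite opprD addrA subrr sub0r dotvNr dotvZr.
by have := H _ mx'; rewrite dotvNr -mulrN leNgt => mv; rewrite mulr_gt0.
Qed.

(** Here the normal is taken at the fixed [x] for the moving target: if the cost did not increase,
    the moved point would lie in the sublevel set through [x], against [0 < dotv m v']. *)
Lemma cost_increases y x n v : 0 < c x y -> level_normal y x n -> 0 < dotv n v ->
  \forall q \near (0 : R, v, y),
    0 < q.1.1 -> c x q.2 < c (x + q.1.1 *: q.1.2) q.2.
Proof.
move=> cxy nxy nv; have near_n := level_normal_near cxy nxy nv.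
pose F : set_system (R * 'rV[R]_d * 'rV[R]_d) := nbhs (0 : R, v, y).
have FF : Filter F by exact: nbhs_filter.
have vF : q.1.2 @[q --> F] --> v by exact: (cvg_comp _ _ cvg_fst cvg_snd).
have yF : q.2 @[q --> F] --> y by exact: cvg_snd.
have xF : (fun=> x) @ F --> x by exact: cvg_cst.
have phiF : (x, q.2, q.1.2) @[q --> F] --> (x, y, v).
  apply: (@cvg_pair _ _ _ F (nbhs (x, y)) (nbhs v)) => //.
  exact: (@cvg_pair _ _ _ F (nbhs x) (nbhs y)).
have H1 : F [set q | forall m, level_normal q.2 x m -> 0 < dotv m q.1.2] :=
  phiF _ near_n.
have cF : c x q.2 @[q --> F] --> c x y by exact: cvg_cost.
have H2 := @cvgr_gt _ _ F FF _ _ cF _ cxy.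
change (F [set q | 0 < q.1.1 -> c x q.2 < c (x + q.1.1 *: q.1.2) q.2]).
apply: filterS2 H1 H2 => -[[t v'] y'] /= H1 cxy' t0.
have [m [mx _]] := level_normal_unique cxy'.
rewrite ltNge; apply/negP => cle.
have := (proj2 mx) _ cle; rewrite addrC addKr dotvZr.
by rewrite leNgt mulr_gt0 // H1.
Qed.

Lemma monotone_section_unique_le (G : set ('rV[R]_d * 'rV[R]_d)) x y0 y1 :
  infty_monotone_set c G -> accessible G x -> G (x, y0) -> G (x, y1) ->
  c x y1 <= c x y0 -> y0 = y1.
Proof.
move=> Gmon Gacc G0 G1 c10.
(* At cost zero there are no normals; both costs vanish and (i) identifies the targets. *)
have [c0|] := eqVneq (c x y0) 0.
  have [y' [_ y'uniq]] := c_zero x; rewrite -(y'uniq _ c0); apply: y'uniq.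
  by apply/eqP; rewrite eq_le c_ge0 andbT -c0.
rewrite neq_lt ltNge c_ge0 /= => cxy0.
have [n0 [n0x _]] := level_normal_unique cxy0.
move: c10; rewrite le_eqVlt => /orP[/eqP c10|c10]; last first.
  have n0N : dotv n0 (- n0) < 0 by rewrite dotvNr (proj1 n0x) oppr_lt0.
  have H1 := cost_decreases y1 cxy0 n0x n0N.
  pose F : set_system (R * 'rV[R]_d * 'rV[R]_d) := nbhs (0 : R, - n0, y1).
  have FF : Filter F by exact: nbhs_filter.
  have cF : c x q.2 @[q --> F] --> c x y1.
    by apply: cvg_cost; [exact: cvg_cst | exact: cvg_snd].
  have H2 := @cvgr_lt _ _ F FF _ _ cF _ c10.
  have [t [v' [y' [t0 Gt [/(_ t0) /= lt1 /= lt2]]]]] := Gacc _ _ _ G1 (filterI H1 H2).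
  (* Both swapped costs [c x y'] and [c x' y0] lie below [c x y0]. *)
  have := Gmon _ _ G0 Gt; rewrite /= ge_max le_max leNgt lt2 /=.
  by rewrite leNgt lt1.
have cxy1 : 0 < c x y1 by rewrite c10.
have [n1 [n1x _]] := level_normal_unique cxy1.
apply: contrapT => y01.
have n01 : n0 != n1.
  apply/eqP => n01; apply: y01; apply: (c_twist cxy0 erefl c10).
  by rewrite (normal_cE cxy0 n0x) (normal_cE cxy1 n1x).
have : 0 < dotv (n0 - n1) (n0 - n1).
  rewrite lt_neqAle eq_sym; apply/andP; split.
    by apply: contra n01 => /eqP/dotv_eq0/eqP; rewrite subr_eq0.
  by rewrite sumr_ge0 // => i _; rewrite -expr2 sqr_ge0.
rewrite dotvBr ![dotv (n0 - n1) _]dotvC !dotvBr.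
rewrite (proj1 n0x) (proj1 n1x) (dotvC n1 n0) => n0n1.
(* For distinct unit vectors [dotv n0 n1 < 1], so [n0 - n1] points out of one sublevel set and into
   the other. *)
have n0v : 0 < dotv n0 (n0 - n1) by rewrite dotvBr (proj1 n0x); lra.
have n1v : dotv n1 (n0 - n1) < 0.
  by rewrite dotvBr (proj1 n1x) dotvC; lra.
have H1 := cost_increases cxy0 n0x n0v.
have H2 := cost_decreases y0 cxy1 n1x n1v.
have [t [v' [y' [t0 Gt [/(_ t0) /= lt1 /(_ t0) /= lt2]]]]] :=
  Gacc _ _ _ G0 (filterI H1 H2).
(* Each swapped cost lies below a different original one: [c x y' < c x' y'] and
   [c x' y1 < c x y1]. *)
have := Gmon _ _ G1 Gt; rewrite /= leNgt gt_max !lt_max lt1 lt2 orbT /=.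
by [].
Qed.

Lemma monotone_section_unique (G : set ('rV[R]_d * 'rV[R]_d)) x y0 y1 :
  infty_monotone_set c G -> accessible G x -> G (x, y0) -> G (x, y1) -> y0 = y1.
Proof.
move=> Gmon Gacc G0 G1; have [c10|/ltW c01] := leP (c x y1) (c x y0).
  exact: monotone_section_unique_le Gmon Gacc G0 G1 c10.
by apply/esym; exact: monotone_section_unique_le Gmon Gacc G1 G0 c01.
Qed.

End quasiconvex_cost.

(** A strict violation is an open condition on pairs of points, so it would already occur within
    [G]. *)
Lemma closure_infty_monotone (R : realType) (d : nat)
    (c : 'rV[R]_d -> 'rV[R]_d -> R) (G : set ('rV[R]_d * 'rV[R]_d)) :
  continuous (fun p : 'rV[R]_d * 'rV[R]_d => c p.1 p.2) ->
  infty_monotone_set c G -> infty_monotone_set c (closure G).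
Proof.
move=> c_cont Gmon p q Gp Gq; rewrite leNgt; apply/negP => lt_max.
pose T : topologicalType := (('rV[R]_d * 'rV[R]_d) * ('rV[R]_d * 'rV[R]_d))%type.
have cT (f g : T -> 'rV[R]_d) : {for (p, q), continuous f} ->
    {for (p, q), continuous g} ->
    {for (p, q), continuous (fun r => c (f r) (g r) : R^o)}.
  move=> fr gr; exact: (@continuous2_cvg _ _ _ _ (nbhs ((p, q) : T)) _ f g c _ _
    (@c_cont (f (p, q), g (p, q))) fr gr).
have p1 : {for (p, q), continuous (fun r : T => r.1.1)}.
  by exact: (cvg_comp _ _ cvg_fst cvg_fst).
have p2 : {for (p, q), continuous (fun r : T => r.1.2)}.
  by exact: (cvg_comp _ _ cvg_fst cvg_snd).
have q1 : {for (p, q), continuous (fun r : T => r.2.1)}.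
  by exact: (cvg_comp _ _ cvg_snd cvg_fst).
have q2 : {for (p, q), continuous (fun r : T => r.2.2)}.
  by exact: (cvg_comp _ _ cvg_snd cvg_snd).
have lhs := continuous_max (cT _ _ p1 p2) (cT _ _ q1 q2).
have rhs := continuous_max (cT _ _ p1 q2) (cT _ _ q1 p2).
have gt0 : 0 < Num.max (c p.1 p.2) (c q.1 q.2) - Num.max (c p.1 q.2) (c q.1 p.2).
  by rewrite subr_gt0.
have FF : Filter (nbhs ((p, q) : T)) by exact: nbhs_filter.
have dif := @cvgB _ R^o _ _ FF _ _ _ _ lhs rhs.
have [[A B] /= [Ap Bq] AB] := @cvgr_gt _ _ _ FF _ _ dif _ gt0.
have [p' [Gp' Ap']] := Gp _ Ap; have [q' [Gq' Bq']] := Gq _ Bq.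
have := AB (p', q') (conj Ap' Bq'); rewrite /= subr_gt0.
by rewrite ltNge Gmon.
Qed.

(** Targets are confined to the cube of half-side [1 / (m + 1)] about the rational point
    [w / (m + 1)]; there are countably many such cells. *)
Definition slab (R : realType) (d : nat) (G : set ('rV[R]_d * 'rV[R]_d))
    (w : {ffun 'I_d -> int}) (m : nat) : set 'rV[R]_d :=
  [set x | exists y : 'rV[R]_d,
     (forall i, `|y 0 i * m.+1%:R - (w i)%:~R| <= 1) /\ G (x, y)].

(** * Accessibility almost everywhere, and Borel projections *)

Section accessibility.
Context {R : realType} {d : nat}.
Implicit Types (G : set ('rV[R]_d * 'rV[R]_d)) (x : 'rV[R]_d).

Lemma floor_dist (a : R) : -1 < (Num.floor a)%:~R - a <= 0.
Proof. have := floor_itv a; rewrite intrD; lra. Qed.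

Lemma unavoided_accessible G x :
  (forall w m w' m', ~ avoids_cone (slab G w m) w' m' x) -> accessible G x.
Proof.
move=> xN y v P Gxy /nbhs_ballP[e /= e0 eP].
have e20 : 0 < e / 2 by rewrite divr_gt0.
(* Two points of a target cell, or of a cone section divided by [n + 1], differ by at most
   [2 / (n + 1) < e] per coordinate. *)
have [n _ /(_ n (leqnn n)) /= ne] := near_infty_natSinv_lt (PosNum e20).
have n0 : 0 < n.+1%:R :> R by [].
have ne' : 2 < e * n.+1%:R.
  by move: ne; rewrite -(ltr_pM2r n0) mulVf ?gt_eqF //; lra.
have en0 : 0 < e / n.+1%:R by rewrite divr_gt0.
(* Dividing the direction [w' + u] by [n + 1] multiplies the scale by [n + 1]; this [m] keeps
   [tau * (n + 1)] below [e]. *)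
have [m _ /(_ m (leqnn m)) /= me] := near_infty_natSinv_lt (PosNum en0).
pose w := [ffun i => Num.floor (y 0 i * n.+1%:R)].
pose w' := [ffun i => Num.floor (v 0 i * n.+1%:R)].
have yw i : `|y 0 i * n.+1%:R - (w i)%:~R| <= 1.
  by have := floor_dist (y 0 i * n.+1%:R); rewrite ffunE ler_norml; lra.
have [tau [u [/andP[tau0 taum] u1 [y' [y'w Gy']]]]] : exists tau (u : 'rV[R]_d),
    [/\ 0 < tau < m.+1%:R^-1, forall i, `|u 0 i| <= 1 &
    slab G w n (\row_i (x 0 i + tau * ((w' i)%:~R + u 0 i)))].
  apply: contrapT => noc; apply: (xN w n w' m); split; first by exists y.
  by move=> tau u tau0 u1 Ax; apply: noc; exists tau, u.
pose v' : 'rV[R]_d := \row_i (((w' i)%:~R + u 0 i) / n.+1%:R).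
have near_v i : `|v 0 i - v' 0 i| < e.
  rewrite -(ltr_pM2r n0) -[X in _ * X](gtr0_norm n0) -normrM mulrBl mxE.
  rewrite divfK ?gt_eqF //; apply: le_lt_trans ne'.
  have := floor_dist (v 0 i * n.+1%:R); have := u1 i.
  by rewrite ffunE !ler_norml; lra.
have near_y i : `|y 0 i - y' 0 i| < e.
  rewrite -(ltr_pM2r n0) -[X in _ * X](gtr0_norm n0) -normrM mulrBl.
  apply: le_lt_trans ne'; have := y'w i; have := yw i.
  by rewrite !ler_norml; lra.
exists (tau * n.+1%:R), v', y'; split; first by rewrite mulr_gt0.
  suff -> : x + (tau * n.+1%:R) *: v' =
      \row_i (x 0 i + tau * ((w' i)%:~R + u 0 i)) by [].
  by apply/rowP => i; rewrite !mxE; field; rewrite gt_eqF.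
apply: eP; split; first split.
- rewrite /ball /= sub0r normrN gtr0_norm ?mulr_gt0 // -ltr_pdivlMr //.
  exact: lt_trans me.
- by split=> // i j; rewrite (ord1 i); exact: near_v.
- by split=> // i j; rewrite (ord1 i); exact: near_y.
Qed.

Lemma accessible_ae (mu : probability (borelRd R d) R) G : abs_cont_leb mu ->
  mu.-negligible ([set x | ~ accessible G x] : set (borelRd R d)).
Proof.
move=> ac.
pose I : countType := ({ffun 'I_d -> int} * nat * ({ffun 'I_d -> int} * nat))%type.
apply: (@negligibleS _ (borelRd R d) _ mu
  (\bigcup_(k : I) avoids_cone (slab G k.1.1 k.1.2) k.2.1 k.2.2)).
  move=> x xN; apply: contrapT => xG; apply: xN; apply: unavoided_accessible.
  by move=> w m w' m' H; apply: xG; exists ((w, m), (w', m')).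
by apply: negligible_bigcup_countType => k; exact: avoids_cone_negligible.
Qed.

Lemma closed_projection_borel G : closed G ->
  measurable ([set x | exists y, G (x, y)] : set (borelRd R d)).
Proof.
move=> cG.
pose K (n : nat) := [set x : 'rV[R]_d | forall i, `[- n%:R : R, n%:R]%classic (x ord0 i)].
have cK n : compact (K n).
  by apply: (@rV_compact R _ (fun=> `[- n%:R : R, n%:R]%classic)) => _; exact: segment_compact.
have Kle x n : `|x| <= n%:R -> K n x.
  move=> xn i; rewrite /= in_itv /= -ler_norml; apply: le_trans xn.
  rewrite [leRHS]/Num.Def.normr /= mx_normrE.
  exact: (le_bigmax _ (fun ij : 'I_1 * 'I_d => `|x ij.1 ij.2|) (ord0, i)).
rewrite (_ : [set x | _] =
    \bigcup_n (fst @` (G `&` (K n `*` K n)))); last first.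
  apply/seteqP; split=> [x [y Gxy]|x [n _ [[x' y] [Gxy _] <-]]]; last by exists y.
  exists (Num.bound (`|x| + `|y|)) => //; exists (x, y) => //; split => //.
  have /ltW xy := archi_boundP (addr_ge0 (normr_ge0 x) (normr_ge0 y)).
  by split; apply: Kle; apply: le_trans xy; rewrite ?lerDl ?lerDr.
apply: bigcupT_measurable => n; apply: closed_borel.
apply: compact_closed; first exact: norm_hausdorff.
apply: continuous_compact.
  by apply: continuous_subspaceT => p; exact: cvg_fst.
apply: (subclosed_compact _ (compact_setX (cK n) (cK n))); last first.
  by move=> p [].
apply: closedI => //; apply: compact_closed; first exact: norm_hausdorff.
exact: compact_setX.
Qed.

End accessibility.

(** * Borel selection from a closed set *)

Section measurable_selection.
Context {R : realType} {d : nat}.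

Lemma measurable_section (G : set ('rV[R]_d * 'rV[R]_d)) (E : set (borelRd R d)) :
  closed G -> measurable E ->
  (forall x y y', ~ E x -> G (x, y) -> G (x, y') -> y = y') ->
  exists T : borelRd R d -> borelRd R d, measurable_fun setT T /\
    forall x y, ~ E x -> G (x, y) -> y = T x.
Proof.
move=> cG mE G1.
(* The default value 0 is taken on [E] and wherever the fibre of [G] is empty. *)
pose T (x : borelRd R d) : borelRd R d :=
  if `[< E x >] then (0 : 'rV[R]_d) else xget (0 : 'rV[R]_d) [set y | G (x, y)].
have TE x y : ~ E x -> G (x, y) -> y = T x.
  move=> NEx Gxy; rewrite /T; case: asboolP => // _.
  by apply: (G1 x) => //; apply: (@xgetPex _ _ [set y | G (x, y)]); exists y.
have T0 x : ~ (~ E x /\ exists y, G (x, y)) -> T x = (0 : 'rV[R]_d).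
  move=> xN; rewrite /T; case: asboolP => // NEx.
  by apply: xgetPN => y Gxy; apply: xN; split=> //; exists y.
exists T; split => //.
have mT (C : set 'rV[R]_d) : closed C -> measurable (T @^-1` C).
  move=> cC; pose D : set (borelRd R d) := ~` E `&` [set x | exists y, G (x, y)].
  have mD : measurable D.
    by apply: measurableI; [exact: measurableC | exact: closed_projection_borel].
  (* The last term accounts for the default: [[set _ | C 0]] is everything or empty, according to
     whether [C] contains 0. *)
  rewrite (_ : _ @^-1` _ =
      (~` E `&` [set x | exists y, (G `&` (snd @^-1` C)) (x, y)]) `|`
      ([set _ | C 0] `&` ~` D)); last first.
    apply/seteqP; split=> x /=.
      have [[NEx [y Gxy]]|xN] := pselect (D x).
        by rewrite -(TE _ _ NEx Gxy) => Cy; left; split=> //; exists y.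
      by rewrite (T0 _ xN) => C0; right.
    move=> [[NEx [y [Gxy Cy]]]|[C0 xN]]; first by rewrite -(TE _ _ NEx Gxy).
    by rewrite (T0 _ xN).
  apply: measurableU; apply: measurableI.
  - exact: measurableC.
  - apply: closed_projection_borel; apply: closedI => //.
    by apply: closed_comp => // p _; exact: cvg_snd.
  - have [C0|C0] := pselect (C 0).
      by rewrite (_ : [set _ | _] = setT) //; apply/seteqP; split.
    by rewrite (_ : [set _ | _] = set0) //; apply/seteqP; split.
  - exact: measurableC.
apply: (@measurability _ _ _ (borelRd R d) _ _ (@open 'rV[R]_d)) => // _ [U oU <-].
rewrite setTI -(setCK U) preimage_setC; apply: measurableC; apply: (mT (~` U)).
exact: open_closedC.
Qed.

End measurable_selection.

(** * Null sets of the plan and its image measure *)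

Lemma measure_eq_mod_null (d0 : measure_display) (T : measurableType d0)
    (R : realType) (mu : {measure set T -> \bar R}) (A B N : set T) :
  measurable A -> measurable B -> measurable N -> mu N = 0%E ->
  (forall x, ~ N x -> A x <-> B x) -> mu A = mu B.
Proof.
move=> mA mB mN N0 AB; rewrite -(measureU0 mA mN N0) -(measureU0 mB mN N0).
congr (mu _); apply/seteqP; split=> x [Hx|]; try by right.
all: have [Nx|/AB xAB] := pselect (N x); [by right | by left; apply/xAB].
Qed.

Theorem theorem2p19 (R : realType) (d : nat)
  (mu nu : probability (borelRd R d) R)
  (c : 'rV[R]_d -> 'rV[R]_d -> R)
  (gam : probability (borelRd R d * borelRd R d)%type R) :
  compact (msupport mu) ->
  compact (msupport nu) ->
  abs_cont_leb mu ->
  continuous (fun p : 'rV[R]_d * 'rV[R]_d => c p.1 p.2) ->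
  (forall x y, 0 <= c x y) ->
  (* (i) *)
  (forall x, exists! y, c x y = 0) ->
  (forall y, inf (range (fun x => c x y)) = 0) ->
  (* (ii) strict quasiconvexity *)
  (forall y x xb (t : R), 0 < t < 1 -> x != xb ->
     c ((1 - t) *: x + t *: xb) y < Num.max (c x y) (c xb y)) ->
  (* (iii) differentiable boundary of sublevel sets *)
  (forall (lam : R) y, 0 < lam -> forall x,
     tboundary (sublevel c y lam) x ->
     exists! n, is_unit_outer_normal (sublevel c y lam) x n) ->
  (* (iv) *)
  (forall x y yt (lam : R), 0 < lam -> c x y = lam -> c x yt = lam ->
     normal_c c y x = normal_c c yt x -> y = yt) ->
  is_plan mu nu gam ->
  infty_monotone c gam ->
  exists T : borelRd R d -> borelRd R d,
    measurable_fun setT T /\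
    concentrated_on gam [set p | p.2 = T p.1] /\
    (forall B : set (borelRd R d), measurable B -> mu (T @^-1` B) = nu B).
Proof.
move=> _ _ ac c_cont c_ge0 c_zero c_inf c_sqc c_smooth c_twist [gam_mu gam_nu].
move=> [G0 [G0mon [N [mN [N0 G0N]]]]].
pose G := closure G0.
have Gmon : infty_monotone_set c G by exact: closure_infty_monotone.
have [E [mE E0 GE]] := accessible_ae G ac.
have section_unique x y y' : ~ E x -> G (x, y) -> G (x, y') -> y = y'.
  move=> NEx; apply: (monotone_section_unique c_cont c_ge0 c_zero c_inf c_sqc
    c_smooth c_twist Gmon).
  by apply: contrapT => xN; apply: NEx; exact: GE.
have [T [mT TG]] := measurable_section (@closed_closure _ G0) mE section_unique.
have mE' : measurable (fst @^-1` E : set (borelRd R d * borelRd R d)).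
  by rewrite -[X in measurable X]setTI; exact: measurable_fst.
(* Outside [N'] the pair lies in [G0] and its first point is accessible; [N'] is null because the
   first marginal of [gam] is [mu]. *)
pose N' : set (borelRd R d * borelRd R d) := N `|` fst @^-1` E.
have mN' : measurable N' by exact: measurableU.
have fE0 : gam (fst @^-1` E) = 0%E by rewrite gam_mu.
have N'0 : gam N' = 0%E by exact: null_set_setU.
have graphT p : ~ N' p -> p.2 = T p.1.
  move=> /not_orP[pN pE]; apply: TG => //; apply: subset_closure.
  by apply: contrapT => pG0; apply: pN; apply: G0N; case: p pG0 {pE}.
exists T; split => //; split.
  exists N'; split => //; split => // p pT; apply: contrapT => pN'.
  by apply: pT; exact: graphT.
move=> B mB; have mTB : measurable (T @^-1` B).
  by rewrite -[X in measurable X]setTI; exact: mT.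
(* Both sides become [gam]-measures of sets that agree wherever [p.2 = T p.1]. *)
rewrite -gam_mu // -gam_nu //; apply: measure_eq_mod_null mN' N'0 _.
- by rewrite -[X in measurable X]setTI; exact: measurable_fst.
- by rewrite -[X in measurable X]setTI; exact: measurable_snd.
- by move=> p /graphT /= ->.
Qed.
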